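(* Pathwise, for every $t\ge0$, every $N\ge2$ and all distinct labels $i,j\in\{1,\dots,N\}$, $$\big\|\Gamma^{(i)}_t-\gamma_{i,t}\big\|_1\le4\,\varepsilon_i,\qquad \big\|\Delta^{(ij)}_t\big\|_1\le64\big(\varepsilon_{ij}+\varepsilon_i^2+\varepsilon_j^2\big).$$
   Context: Setting. Fix an integer $2\le d<\infty$, $M_d=M_d(\mathbb C)$. Let $H=H^\ast\in M_d$, $L\in M_d$, and $A=A^\ast\in M_{d^2}(\mathbb C)$ acting on $\mathbb C^d\otimes\mathbb C^d$ with kernel symmetry $A(x,y;x',y')=A(y,x;y',x')$, $A(x,y;x',y')=A(x',y';x,y)$. $\|\cdot\|_1$ is the trace norm. Define $\mathcal D\rho=L\rho L^\ast-\tfrac12\{L^\ast L,\rho\}$, $\mathcal M[\rho]=L\rho+\rho L^\ast-\operatorname{Tr}((L+L^\ast)\rho)\rho$, $\mathsf B(\rho)=\operatorname{Tr}_2(A(1\otimes\rho))$. $N$-particle filter in vector form. $B_1,\dots,B_N$ are independent standard Brownian motions; a subscript $j$ means action on slot $j$ of $(\mathbb C^d)^{\otimes N}$, $A_{ij}$ is $A$ acting on slots $i,j$; $H_N=\sum_{j\le N}H_j+\frac1N\sum_{i<j\le N}A_{ij}$. $\Psi_t$ is the unique solution, with $\|\Psi_t\|=1$, of $$d\Psi_t=\Big(-iH_N-\tfrac12\sum_{j}\big(L_j^\ast L_j-\mu^{(j)}_tL_j+\tfrac14(\mu^{(j)}_t)^2\big)\Big)\Psi_tdt+\sum_{j}\Big(L_j-\tfrac{\mu^{(j)}_t}2\Big)\Psi_tdB_j(t),\quad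 \mu^{(j)}_t=\langle\Psi_t,(L_j+L_j^\ast)\Psi_t\rangle,$$ with $\Psi_0=\phi_0^{\otimes N}$, $\gamma_0=|\phi_0\rangle\langle\phi_0|$ a deterministic pure state; $\Gamma^N_t=|\Psi_t\rangle\langle\Psi_t|$. Reference filters. $d\gamma_{j,t}=(-i[H+\mathsf B(\eta_t),\gamma_{j,t}]+\mathcal D\gamma_{j,t})dt+\mathcal M[\gamma_{j,t}]dB_j(t)$, $\gamma_{j,0}=\gamma_0$, $\eta_t=\mathbb E\gamma_{1,t}$; $\gamma_{j,t}=|\phi_{j,t}\rangle\langle\phi_{j,t}|$ is a rank-one projection. Reduced states and amplitudes: $\Gamma^{(S)}_t=\operatorname{Tr}_{S^c}\Gamma^N_t$; $\Delta^{(ij)}_t=\Gamma^{(i,j)}_t-\Gamma^{(i)}_t\otimes\Gamma^{(j)}_t$ (particle $i$ in the first slot); $q_j=1-|\phi_{j,t}\rangle\langle\phi_{j,t}|$ on slot $j$; $\varepsilon_i=\|q_i\Psi_t\|$, $\varepsilon_{ij}=\|q_iq_j\Psi_t\|$. *)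

(* Defs.v *)
From HB Require Import structures.
From mathcomp Require Import all_boot all_order all_algebra.
From mathcomp Require Import sesquilinear spectral.
From mathcomp Require Import all_classical all_reals all_analysis.
From mathcomp Require Import complex mxtens.

Set Implicit Arguments.
Unset Strict Implicit.
Unset Printing Implicit Defensive.

Import Order.TTheory GRing.Theory Num.Theory.
Import numFieldNormedType.Exports.

Local Open Scope classical_set_scope.
Local Open Scope ring_scope.
Local Open Scope sesquilinear_scope.

(* Time is [0, +oo[: values of processes and filtrations at negative times are
   never used. *)

Section Stochastic.
Context {disp : measure_display} {Omega : measurableType disp} {R : realType}.
Variable P : probability Omega R.
Implicit Types (F : R -> set (set Omega)) (f : Omega -> R) (t : R).

Definition filtration F : Prop :=
  [/\ forall t, 0 <= t -> sigma_algebra setT (F t),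
      forall t, 0 <= t -> F t `<=` measurable
    & forall s t, 0 <= s -> s <= t -> F s `<=` F t].

Definition measurable_wrt (G : set (set Omega)) f : Prop :=
  forall Y : set R, measurable Y -> G (f @^-1` Y).

Definition adapted F (X : R -> Omega -> R) : Prop :=
  forall t, 0 <= t -> measurable_wrt (F t) (X t).

Definition continuous_paths (X : R -> Omega -> R) : Prop :=
  forall w, {within `[0, +oo[, continuous (fun t => X t w)}.

(* The second parameter of normal_prob is the standard deviation. *)
Definition brownian_motion F (B : R -> Omega -> R) : Prop :=
  [/\ adapted F B, continuous_paths B, forall w, B 0 w = 0
    & forall s t, 0 <= s -> s < t ->
      (forall Y : set R, measurable Y ->
        P [set w | Y (B t w - B s w)] = normal_prob 0 (Num.sqrt (t - s)) Y) /\
      (forall (G : set Omega) (Y : set R), F s G -> measurable Y ->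
        P (G `&` [set w | Y (B t w - B s w)]) =
        (P G * P [set w | Y (B t w - B s w)%R])%E)].

Definition process_sigma (X : R -> Omega -> R) : set (set Omega) :=
  <<s \bigcup_(t in [set t | 0 <= t])
        preimage_set_system setT (X t) measurable >>.

(* Subfamilies are covered by taking some of the events to be setT. *)
Definition independent_processes (J : finType) (B : J -> R -> Omega -> R) :
    Prop :=
  forall G : J -> set Omega, (forall j, process_sigma (B j) (G j)) ->
    P (\bigcap_(j in [set: J]) G j) = (\prod_(j : J) fine (P (G j)))%:E.

Definition cvg_in_probability (X : nat -> Omega -> \bar R) : Prop :=
  forall e : R, 0 < e -> P [set w | (e%:E <= X n w)%E] @[n --> \oo] --> 0%E.

(* A simple integrand: the value coef k on ]knot k, knot k.+1] for k < steps,
   and 0 elsewhere. *)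
Record simple_integrand F := SimpleIntegrand {
  steps : nat;
  knot : nat -> R;
  coef : nat -> Omega -> R;
  knot_ge0 : 0 <= knot 0%N;
  knot_ndecr : forall k, knot k <= knot k.+1;
  coef_measurable : forall k, measurable_wrt (F (knot k)) (coef k);
  coef_bounded : forall k, exists M : R, forall w, `|coef k w| <= M }.

Definition simple_value F (S : simple_integrand F) t (w : Omega) : R :=
  \sum_(k < steps S) coef S k w * \1_(`]knot S k, knot S k.+1]) t.

Definition simple_integral F (S : simple_integrand F) (B : R -> Omega -> R)
    t (w : Omega) : R :=
  \sum_(k < steps S) coef S k w *
    (B (Num.min (knot S k.+1) t) w - B (Num.min (knot S k) t) w).

(* I is (a version of) the Ito integral of b against B over [0, t], for b
   square integrable in time on almost every path: the limit in probability of
   the elementary integrals of simple integrands S_n such that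
   int_0^t (S_n - b)^2 ds tends to 0 in probability. *)
Definition is_ito_integral F (B b : R -> Omega -> R) t (I : Omega -> R) : Prop :=
  measurable_fun setT I /\
  exists S : nat -> simple_integrand F,
    cvg_in_probability (fun n w =>
      \int[lebesgue_measure]_(s in `[0%R, t])
        ((simple_value (S n) s w - b s w) ^+ 2)%R%:E)%E /\
    cvg_in_probability (fun n w => `|simple_integral (S n) B t w - I w|%:E).

Definition cintegral {d'} {T : measurableType d'}
    (mu : {measure set T -> \bar R}) (D : set T) (f : T -> R[i]) : R[i] :=
  Complex (\int[mu]_(x in D) complex.Re (f x))
          (\int[mu]_(x in D) complex.Im (f x)).

(* dX = a dt + sum_j b_j dB_j, for a complex continuous adapted process X. *)
Definition solves_sde F (J : finType) (B : J -> R -> Omega -> R)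
    (X a : R -> Omega -> R[i]) (b : J -> R -> Omega -> R[i]) : Prop :=
  [/\ adapted F (fun t w => complex.Re (X t w)) /\
      adapted F (fun t w => complex.Im (X t w)),
      continuous_paths (fun t w => complex.Re (X t w)) /\
      continuous_paths (fun t w => complex.Im (X t w))
    & forall t, 0 <= t -> exists I : J -> Omega -> R[i],
      (forall j,
         is_ito_integral F (B j) (fun s w => complex.Re (b j s w)) t
           (fun w => complex.Re (I j w)) /\
         is_ito_integral F (B j) (fun s w => complex.Im (b j s w)) t
           (fun w => complex.Im (I j w))) /\
      {ae P, forall w, X t w = X 0 w
         + cintegral (@lebesgue_measure R) `[0, t] (fun s => a s w)
         + \sum_(j : J) I j w}].

End Stochastic.

Section Matrices.
Context {R : realType}.
Local Notation C := R[i].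

(* The sum of the singular values. *)
Definition trace_norm n (X : 'M[C]_n) : C :=
  \sum_(k < n) sqrtC (spectral_diag (X^t* *m X) 0 k).

Definition vnorm (T : finType) (v : T -> C) : C :=
  sqrtC (\sum_(x : T) `|v x| ^+ 2).

Definition commutator n (X Y : 'M[C]_n) : 'M[C]_n := X *m Y - Y *m X.

(* C^d (x) C^d is indexed by mxtens_index, as for the Kronecker product
   tensmx, so the kernel A(x,y;x',y') is
   A (mxtens_index (x, y)) (mxtens_index (x', y')). *)
Definition kernel2 d (A : 'M[C]_(d * d)) (x y x' y' : 'I_d) : C :=
  A (mxtens_index (x, y)) (mxtens_index (x', y')).

Definition partial_trace2 d (X : 'M[C]_(d * d)) : 'M[C]_d :=
  \matrix_(x, x') \sum_(y < d) kernel2 X x y x' y.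

Definition mean_field d (A : 'M[C]_(d * d)) (rho : 'M[C]_d) : 'M[C]_d :=
  partial_trace2 (A *m tensmx 1%:M rho).

Definition lindblad d (L rho : 'M[C]_d) : 'M[C]_d :=
  L *m rho *m L^t* - 2^-1 *: (L^t* *m L *m rho + rho *m (L^t* *m L)).

Definition innovation d (L rho : 'M[C]_d) : 'M[C]_d :=
  L *m rho + rho *m L^t* - \tr ((L + L^t*) *m rho) *: rho.

Definition filter_drift d (H L : 'M[C]_d) (A : 'M[C]_(d * d))
    (eta rho : 'M[C]_d) : 'M[C]_d :=
  - 'i *: commutator (H + mean_field A eta) rho + lindblad L rho.

End Matrices.

Section Particles.
Context {R : realType} (N d : nat).
Local Notation C := R[i].

(* (C^d)^{(x) N} is the space of functions on configurations. *)
Definition config := {ffun 'I_N -> 'I_d}.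

Definition update (x : config) (i : 'I_N) (a : 'I_d) : config :=
  [ffun k => if k == i then a else x k].

Definition slot (M : 'M[C]_d) (j : 'I_N) (psi : config -> C) : config -> C :=
  fun x => \sum_(a < d) M (x j) a * psi (update x j a).

Definition slot2 (A : 'M[C]_(d * d)) (i j : 'I_N) (psi : config -> C) :
    config -> C :=
  fun x => \sum_(a < d) \sum_(b < d)
    kernel2 A (x i) (x j) a b * psi (update (update x i a) j b).

Definition inner (psi chi : config -> C) : C :=
  \sum_(x : config) (psi x)^* * chi x.

Definition product_vector (phi : 'cV[C]_d) : config -> C :=
  fun x => \prod_(j < N) phi (x j) 0.

Definition hamiltonian (H : 'M[C]_d) (A : 'M[C]_(d * d)) (psi : config -> C) :
    config -> C :=
  fun x => \sum_(j < N) slot H j psi x +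
    N%:R^-1 * \sum_(i < N) \sum_(j < N | (i < j)%N) slot2 A i j psi x.

Definition mu (L : 'M[C]_d) (j : 'I_N) (psi : config -> C) : C :=
  inner psi (slot (L + L^t*) j psi).

Definition vector_drift (H L : 'M[C]_d) (A : 'M[C]_(d * d))
    (psi : config -> C) : config -> C :=
  fun x => - 'i * hamiltonian H A psi x - 2^-1 * \sum_(j < N)
    (slot (L^t* *m L) j psi x - mu L j psi * slot L j psi x
     + 4^-1 * mu L j psi ^+ 2 * psi x).

Definition vector_noise (L : 'M[C]_d) (j : 'I_N) (psi : config -> C) :
    config -> C :=
  fun x => slot L j psi x - mu L j psi / 2 * psi x.

(* Kernels of operators on (C^d)^{(x) N}, and their partial traces: the labels
   outside S are set equal in both arguments and summed over. *)
Definition pure_kernel (psi : config -> C) : config -> config -> C :=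
  fun x x' => psi x * (psi x')^*.

Definition reduced1 (G : config -> config -> C) (i : 'I_N) : 'M[C]_d :=
  \matrix_(a, a') \sum_(x : config | x i == a) G x (update x i a').

Definition reduced2 (G : config -> config -> C) (i j : 'I_N) :
    'M[C]_(d * d) :=
  \matrix_(k, k') \sum_(x : config | (x i, x j) == mxtens_unindex k)
    G x (update (update x i (mxtens_unindex k').1) j (mxtens_unindex k').2).

Definition correlation (G : config -> config -> C) (i j : 'I_N) :
    'M[C]_(d * d) :=
  reduced2 G i j - tensmx (reduced1 G i) (reduced1 G j).

(* |phi><phi| *)
Definition ketbra (phi : 'cV[C]_d) : 'M[C]_d := phi *m phi^t*.

Definition unit_vector (phi : 'cV[C]_d) : Prop :=
  vnorm (fun a => phi a 0) = 1.

Definition excite (phi : 'cV[C]_d) (j : 'I_N) (psi : config -> C) :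
    config -> C :=
  slot (1%:M - ketbra phi) j psi.

End Particles.

Section Filters.
Context {disp : measure_display} {Omega : measurableType disp} {R : realType}.
Variable P : probability Omega R.
Local Notation C := R[i].

(* The solution is taken in the version all of whose paths lie on the unit
   sphere. *)
Definition particle_filter (F : R -> set (set Omega)) (N d : nat)
    (H L : 'M[C]_d) (A : 'M[C]_(d * d)) (phi0 : 'cV[C]_d)
    (B : 'I_N -> R -> Omega -> R) (Psi : R -> Omega -> config N d -> C) :
    Prop :=
  [/\ forall w x, Psi 0 w x = product_vector phi0 x,
      forall t w, 0 <= t -> vnorm (Psi t w) = 1
    & forall x, solves_sde P F B (fun t w => Psi t w x)
        (fun t w => vector_drift H L A (Psi t w) x)
        (fun j t w => vector_noise L j (Psi t w) x)].

Definition mean_state d (gamma : R -> Omega -> 'M[C]_d) (t : R) : 'M[C]_d :=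
  \matrix_(a, b) cintegral P setT (fun w => gamma t w a b).

(* The nonlinear filter driven by B in the external mean state eta, together
   with unit vectors phi t w representing its pure states. *)
Definition reference_filter (F : R -> set (set Omega)) (d : nat)
    (H L : 'M[C]_d) (A : 'M[C]_(d * d)) (phi0 : 'cV[C]_d)
    (eta : R -> 'M[C]_d) (B : R -> Omega -> R)
    (gamma : R -> Omega -> 'M[C]_d) (phi : R -> Omega -> 'cV[C]_d) : Prop :=
  [/\ forall w, gamma 0 w = ketbra phi0,
      forall t w, 0 <= t ->
        unit_vector (phi t w) /\ gamma t w = ketbra (phi t w)
    & forall a b, solves_sde P F (fun _ : unit => B)
        (fun t w => gamma t w a b)
        (fun t w => filter_drift H L A (eta t) (gamma t w) a b)
        (fun _ t w => innovation L (gamma t w) a b)].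

End Filters.

(* Main.v *)
Require Import Defs.
From HB Require Import structures.
From mathcomp Require Import all_boot all_order all_algebra.
From mathcomp Require Import sesquilinear spectral.
From mathcomp Require Import all_classical all_reals all_analysis.
From mathcomp Require Import complex mxtens.
From mathcomp Require Import ring.

(** Only linear algebra at a fixed time and path is involved: [Psi t w] is a
    unit vector and [gamma k t w = |phi_k><phi_k|] with [phi_k] a unit vector.

    Trace norms are bounded by duality: [X] has trace norm at most [c] as soon
    as [|Tr (U X)| <= c] for every operator [U] of norm at most one
    ([trace_norm_le], from the polar decomposition). This form of the bound
    is additive, is multiplicative under tensor products
    ([nuclear_le_tensor]), and bounds [\sum_s |f s><g s|] by the product of the
    Hilbert-Schmidt norms of [f] and [g] ([nuclear_le_gram]).

    View [Psi] as a family [psi] of vectors of the slots [i] and [j], indexed by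
    the states of the other slots. Then, with [(x)] the tensor product,
    [psi = phi (x) chi c + x (x) chi + phi (x) y + z], where [phi = phi_i],
    [chi = phi_j], the families [x] and [y] are orthogonal to [phi] and [chi]
    and of norms at most [eps_i] and [eps_j], and [z] has norm [eps_ij].

    - One particle: writing [f = p f + q f] in the density of a unit family [f],
      every term except that of [p f] contains the factor [q f], and the density
      of [p f] is [(1 - |q f| ^ 2) |phi><phi|] ([nuclear_le_gram_outer]).
    - Two particles: put [P = |phi><phi|] and [Q = |chi><chi|], and let [G12],
      [G1], [G2] be the reduced states. The correlation is
      [(G12 - G1 (x) Q - P (x) G2 + P (x) Q) - (G1 - P) (x) (G2 - Q)].
      The last product has norm at most [16 eps_i eps_j] by the one-particle
      bound. In the first bracket replace [psi] by [psi - z], which costs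
      [9 eps_ij]. The terms with only one particle excited, on one side or on
      both, then cancel, and so do the multiples of [P (x) Q], up to the defect
      in the normalisation of [psi - z]. There remain
      [|x (x) chi><phi (x) y|], its adjoint, and [|z| ^ 2 P (x) Q]
      ([gram_first_order]), of total norm at most
      [2 eps_i eps_j + eps_ij ^ 2]. *)

Set Implicit Arguments.
Unset Strict Implicit.
Unset Printing Implicit Defensive.

Import Order.TTheory GRing.Theory Num.Theory.
Import numFieldNormedType.Exports.

Local Open Scope classical_set_scope.
Local Open Scope ring_scope.
Local Open Scope sesquilinear_scope.

(** * Euclidean norm of families of complex numbers *)

Section VectorNorm.
Context {R : realType}.
Local Notation C := R[i].

Lemma sum_pair (S T : finType) (F : S * T -> C) :
  \sum_p F p = \sum_a \sum_b F (a, b).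
Proof.
by rewrite (pair_bigA _ (fun a b => F (a, b))); apply: eq_bigr => -[].
Qed.

Lemma vnorm_sqr (T : finType) (f : T -> C) :
  vnorm f ^+ 2 = \sum_x `|f x| ^+ 2.
Proof. exact: sqrtCK. Qed.

Lemma vnorm_sqrM (T : finType) (f : T -> C) :
  vnorm f ^+ 2 = \sum_x f x * (f x)^*.
Proof. by rewrite vnorm_sqr; apply: eq_bigr => x _; rewrite normCK. Qed.

Lemma vnorm_ge0 (T : finType) (f : T -> C) : 0 <= vnorm f.
Proof. by rewrite sqrtC_ge0 sumr_ge0 // => x _; rewrite exprn_ge0. Qed.
Hint Resolve vnorm_ge0 : core.

Lemma eq_vnorm (T : finType) (f g : T -> C) : f =1 g -> vnorm f = vnorm g.
Proof. by move=> fg; congr sqrtC; apply: eq_bigr => x _; rewrite fg. Qed.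

Lemma vnorm_le (S T : finType) (f : S -> C) (g : T -> C) :
  vnorm f ^+ 2 <= vnorm g ^+ 2 -> vnorm f <= vnorm g.
Proof. by rewrite ler_pXn2r ?nnegrE. Qed.

Lemma vnorm_conj (T : finType) (f : T -> C) :
  vnorm (fun x => (f x)^*) = vnorm f.
Proof. by congr sqrtC; apply: eq_bigr => x _; rewrite norm_conjC. Qed.

(** Cauchy-Schwarz for nonnegative families, by expanding
    [\sum_(x, y) (a x * b y - a y * b x) ^+ 2 >= 0]. *)
Lemma sum_cauchy (T : finType) (a b : T -> C) :
  (forall x, 0 <= a x) -> (forall x, 0 <= b x) ->
  (\sum_x a x * b x) ^+ 2 <= (\sum_x a x ^+ 2) * (\sum_x b x ^+ 2).
Proof.
move=> a0 b0.
have : 0 <= \sum_x \sum_y (a x * b y - a y * b x) ^+ 2.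
  rewrite sumr_ge0 // => x _; rewrite sumr_ge0 // => y _.
  by rewrite real_exprn_even_ge0 // rpredB ?rpredM ?ger0_real.
have -> : \sum_x \sum_y (a x * b y - a y * b x) ^+ 2 =
  \sum_x \sum_y a x ^+ 2 * b y ^+ 2 + \sum_x \sum_y b x ^+ 2 * a y ^+ 2
  - 2 * \sum_x \sum_y (a x * b x) * (a y * b y).
  rewrite mulr_sumr -sumrN -!big_split; apply: eq_bigr => x _ /=.
  by rewrite mulr_sumr -sumrN -!big_split; apply: eq_bigr => y _ /=; ring.
rewrite -!big_distrlr /= -expr2 [X in _ + X - _]mulrC -mulr2n.
rewrite -[_ *+ 2]mulr_natl.
by rewrite -mulrBr pmulr_rge0 ?ltr0n // subr_ge0.
Qed.

Lemma cauchy_schwarz (T : finType) (f g : T -> C) :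
  `|\sum_x f x * g x| <= vnorm f * vnorm g.
Proof.
apply: le_trans (ler_norm_sum _ _ _) _.
rewrite -(@ler_pXn2r _ 2) ?nnegrE ?mulr_ge0 ?sumr_ge0 // exprMn !vnorm_sqr.
under eq_bigr do rewrite normrM.
exact: sum_cauchy.
Qed.

End VectorNorm.

(** * Operator and trace norm bounds for kernels on a finite set *)

Section Duality.
Context {R : realType}.
Local Notation C := R[i].

(** [opnorm_le U m]: the operator with kernel [U] has operator norm at most
    [m], expressed through its sesquilinear form. *)
Definition opnorm_le (T : finType) (U : T -> T -> C) (m : C) : Prop :=
  0 <= m /\ forall f g : T -> C,
    `|\sum_x \sum_y g x * U x y * f y| <= m * (vnorm f * vnorm g).

(** [nuclear_le K c]: the operator with kernel [K] has trace norm at most [c],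
    as the norm dual to the operator norm under the pairing
    [(U, K) |-> Tr (U K)]. *)
Definition nuclear_le (T : finType) (K : T -> T -> C) (c : C) : Prop :=
  forall U m, opnorm_le U m -> `|\sum_x \sum_y U x y * K y x| <= m * c.

(** The kernel of [\sum_s |f s><g s|]. *)
Definition gram (S T : finType) (f g : S -> T -> C) : T -> T -> C :=
  fun x y => \sum_s f s x * (g s y)^*.

(** The Hilbert-Schmidt norm of a family of vectors. *)
Definition hsnorm (S T : finType) (f : S -> T -> C) : C :=
  vnorm (fun p : S * T => f p.1 p.2).

(** The kernel of the tensor product of two operators. *)
Definition tensor (S T : finType) (K : S -> S -> C) (K' : T -> T -> C) :
    S * T -> S * T -> C :=
  fun p q => K p.1 q.1 * K' p.2 q.2.

Lemma hsnorm_ge0 (S T : finType) (f : S -> T -> C) : 0 <= hsnorm f.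
Proof. exact: vnorm_ge0. Qed.

Lemma hsnorm_sqr (S T : finType) (f : S -> T -> C) :
  hsnorm f ^+ 2 = \sum_s vnorm (f s) ^+ 2.
Proof.
rewrite vnorm_sqr sum_pair.
by apply: eq_bigr => s _; rewrite vnorm_sqr.
Qed.

Lemma nuclear_le_eq (T : finType) (K K' : T -> T -> C) c :
  (forall x y, K x y = K' x y) -> nuclear_le K c -> nuclear_le K' c.
Proof.
move=> KK' Kc U m /Kc; congr (`|_| <= _); apply: eq_bigr => x _.
by apply: eq_bigr => y _; rewrite KK'.
Qed.

Lemma nuclear_leW (T : finType) (K : T -> T -> C) c c' :
  c <= c' -> nuclear_le K c -> nuclear_le K c'.
Proof.
by move=> cc' Kc U m Um; apply: le_trans (Kc _ _ Um) _; rewrite ler_wpM2l ?Um.1.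
Qed.

Lemma nuclear_leD (T : finType) (K K' : T -> T -> C) c c' :
  nuclear_le K c -> nuclear_le K' c' ->
  nuclear_le (fun x y => K x y + K' x y) (c + c').
Proof.
move=> Kc Kc' U m Um; rewrite mulrDr.
under eq_bigr do
  (under eq_bigr do rewrite mulrDr; rewrite big_split /=).
rewrite big_split /=; apply: le_trans (ler_normD _ _) _.
by rewrite lerD ?Kc ?Kc'.
Qed.

Lemma nuclear_leZ (T : finType) (a : C) (K : T -> T -> C) c :
  nuclear_le K c -> nuclear_le (fun x y => a * K x y) (`|a| * c).
Proof.
move=> Kc U m Um; rewrite mulrCA.
under eq_bigr do
  (under eq_bigr do rewrite mulrCA; rewrite -mulr_sumr).
by rewrite -mulr_sumr normrM ler_wpM2l ?Kc.
Qed.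

Lemma nuclear_leN (T : finType) (K : T -> T -> C) c :
  nuclear_le K c -> nuclear_le (fun x y => - K x y) c.
Proof.
move=> /(nuclear_leZ (-1)); rewrite normrN normr1 mul1r.
by apply: nuclear_le_eq => x y; rewrite mulN1r.
Qed.

(** Hoelder's inequality for two Hilbert-Schmidt factors. *)
Lemma nuclear_le_gram (S T : finType) (f g : S -> T -> C) :
  nuclear_le (gram f g) (hsnorm f * hsnorm g).
Proof.
move=> U m [m0 Um].
have -> : \sum_x \sum_y U x y * gram f g y x =
    \sum_s \sum_x \sum_y (g s x)^* * U x y * f s y.
  rewrite [RHS]exchange_big /=; apply: eq_bigr => x _.
  rewrite [RHS]exchange_big; apply: eq_bigr => y _ /=.
  by rewrite /gram mulr_sumr; apply: eq_bigr => s _; ring.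
apply: le_trans (ler_norm_sum _ _ _) _.
apply: (@le_trans _ _ (m * \sum_s vnorm (f s) * vnorm (g s))).
  rewrite mulr_sumr ler_sum // => s _; apply: le_trans (Um _ _) _.
  by rewrite vnorm_conj.
have ge0 : 0 <= \sum_s vnorm (f s) * vnorm (g s).
  by apply: sumr_ge0 => s _; rewrite mulr_ge0 ?vnorm_ge0.
apply: ler_wpM2l => //.
rewrite -(@ler_pXn2r _ 2) ?nnegrE ?mulr_ge0 ?hsnorm_ge0 //.
by rewrite exprMn !hsnorm_sqr; apply: sum_cauchy => s; apply: vnorm_ge0.
Qed.

Lemma vnorm_tensor (S T : finType) (f : S -> C) (g : T -> C) :
  vnorm (fun p : S * T => f p.1 * g p.2) = vnorm f * vnorm g.
Proof.
apply: (@pexpIrn _ 2); rewrite ?nnegrE ?mulr_ge0 ?vnorm_ge0 // exprMn !vnorm_sqr.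
rewrite sum_pair big_distrlr /=.
by apply: eq_bigr => x _; apply: eq_bigr => y _; rewrite normrM exprMn.
Qed.

(** Contracting one tensor factor of an operator [U] against [K] leaves an
    operator of norm at most that of [U] times the trace norm of [K]. *)
Lemma nuclear_le_tensor (S T : finType) (K : S -> S -> C) (K' : T -> T -> C)
    c c' :
  nuclear_le K c -> nuclear_le K' c' -> nuclear_le (tensor K K') (c * c').
Proof.
move=> Kc Kc' U m [m0 Um].
pose V b b' := \sum_a \sum_a' U (a, b) (a', b') * K a' a.
suff Vm : opnorm_le V (m * c).
  have := Kc' _ _ Vm; rewrite mulrA; congr (`|_| <= _).
  rewrite sum_pair [RHS]exchange_big; apply: eq_bigr => b _ /=.
  transitivity (\sum_a \sum_b' \sum_a' U (a, b) (a', b') * K a' a * K' b' b).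
    rewrite [RHS]exchange_big; apply: eq_bigr => b' _ /=.
    by rewrite /V mulr_suml; apply: eq_bigr => a _; rewrite mulr_suml.
  apply: eq_bigr => a _; rewrite exchange_big sum_pair /=.
  apply: eq_bigr => a' _; apply: eq_bigr => b' _.
  by rewrite /tensor mulrA.
have W f g : opnorm_le
    (fun a a' => \sum_b \sum_b' g b * U (a, b) (a', b') * f b')
    (m * (vnorm f * vnorm g)).
  split=> [|h k]; first by rewrite !mulr_ge0 ?vnorm_ge0.
  have := Um (fun p => h p.1 * f p.2) (fun p => k p.1 * g p.2).
  rewrite !vnorm_tensor.
  have -> : m * (vnorm h * vnorm f * (vnorm k * vnorm g)) =
    m * (vnorm f * vnorm g) * (vnorm h * vnorm k) by ring.
  congr (`|_| <= _).
  rewrite sum_pair; apply: eq_bigr => a _ /=.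
  transitivity (\sum_b \sum_a' \sum_b'
      k a * g b * U (a, b) (a', b') * (h a' * f b')).
    by apply: eq_bigr => b _; rewrite sum_pair.
  rewrite exchange_big; apply: eq_bigr => a' _ /=.
  rewrite mulr_sumr mulr_suml; apply: eq_bigr => b _.
  by rewrite mulr_sumr mulr_suml; apply: eq_bigr => b' _; ring.
have key f g : `|\sum_b \sum_b' g b * V b b' * f b'| <=
    m * (vnorm f * vnorm g) * c.
  have := Kc _ _ (W f g); congr (`|_| <= _).
  transitivity (\sum_a \sum_a' \sum_b \sum_b'
      g b * (U (a, b) (a', b') * K a' a) * f b').
    apply: eq_bigr => a _; apply: eq_bigr => a' _; rewrite mulr_suml.
    by apply: eq_bigr => b _; rewrite mulr_suml; apply: eq_bigr => b' _; ring.
  under eq_bigr do rewrite exchange_big /=.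
  rewrite exchange_big; apply: eq_bigr => b _ /=.
  transitivity (\sum_a \sum_b' \sum_a'
      g b * (U (a, b) (a', b') * K a' a) * f b').
    by apply: eq_bigr => a _; rewrite exchange_big.
  rewrite exchange_big; apply: eq_bigr => b' _ /=.
  rewrite /V mulr_sumr mulr_suml; apply: eq_bigr => a _.
  by rewrite mulr_sumr mulr_suml.
split=> [|f g]; last by have := key f g; rewrite mulrAC.
(* Testing [Kc] on the zero operator shows that [m * c] is nonnegative. *)
have Um' : opnorm_le (fun _ _ : S => 0 : C) m.
  split=> // f g; rewrite big1 ?normr0 ?mulr_ge0 ?vnorm_ge0 // => x _.
  by rewrite big1 // => y _; rewrite mulr0 mul0r.
by apply: le_trans (Kc _ _ Um'); apply: normr_ge0.
Qed.

Lemma nuclear_le_reindex (S T : finType) (h : S -> T) (K : T -> T -> C) c :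
  bijective h -> nuclear_le K c -> nuclear_le (fun x y => K (h x) (h y)) c.
Proof.
case=> h' hK h'K Kc U m [m0 Um].
have hbij : bijective h by exists h'.
have h'bij : bijective h' by exists h.
have vh f : vnorm (f \o h) = vnorm f.
  congr sqrtC; rewrite [RHS](reindex h) //=; exact: onW_bij.
have Vm : opnorm_le (fun x y => U (h' x) (h' y)) m.
  split=> // f g; have := Um (f \o h) (g \o h); rewrite !vh; congr (`|_| <= _).
  rewrite [LHS](reindex h') /=; last exact: onW_bij.
  apply: eq_bigr => x _; rewrite (reindex h') /=; last exact: onW_bij.
  by apply: eq_bigr => y _; rewrite !h'K.
have := Kc _ _ Vm; congr (`|_| <= _).
rewrite [LHS](reindex h) /=; last exact: onW_bij.
apply: eq_bigr => x _; rewrite (reindex h) /=; last exact: onW_bij.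
by apply: eq_bigr => y _; rewrite !hK.
Qed.

End Duality.

(** * Trace norm of a matrix by duality *)

Section TraceNorm.
Context {R : realType}.
Local Notation C := R[i].

Lemma vnorm_sqr_orthogonal (I T : finType) (M : I -> T -> C) (e h : I -> C) :
  (forall k l, \sum_y M k y * (M l y)^* = (k == l)%:R * e k) ->
  vnorm (fun y => \sum_k h k * M k y) ^+ 2 = \sum_k `|h k| ^+ 2 * e k.
Proof.
move=> Me; rewrite vnorm_sqrM.
transitivity (\sum_k \sum_l h k * (h l)^* * \sum_y M k y * (M l y)^*).
  transitivity (\sum_y \sum_k \sum_l h k * (h l)^* * (M k y * (M l y)^*)).
    apply: eq_bigr => y _; rewrite rmorph_sum big_distrlr /=.
    by apply: eq_bigr => k _; apply: eq_bigr => l _; rewrite rmorphM /=; ring.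
  rewrite exchange_big; apply: eq_bigr => k _.
  by rewrite exchange_big; apply: eq_bigr => l _; rewrite mulr_sumr.
apply: eq_bigr => k _; rewrite (bigD1 k) //= [X in _ + X]big1 ?addr0 => [|l lk].
    by rewrite Me eqxx mul1r normCK.
by rewrite Me eq_sym (negPf lk) mul0r mulr0.
Qed.

(** By the spectral theorem [X = V * diag s * S] with [S] unitary, [s] the
    singular values and [V] a partial isometry; the operator [U = S^* V^*] has
    norm at most one and [Tr (U X)] is the sum of the singular values. *)
Lemma trace_norm_le n (X : 'M[C]_n) (c : C) :
  nuclear_le (fun x y => X x y) c -> trace_norm X <= c.
Proof.
move=> Xc.
pose S := spectralmx (X^t* *m X); pose D := spectral_diag (X^t* *m X).
have SSt : S *m S^t* = 1%:M by apply/unitarymxP/spectral_unitarymx.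
have StS : S^t* *m S = 1%:M by apply: mulmx1C.
have tcM p q r (M : 'M[C]_(p, q)) (M' : 'M[C]_(q, r)) :
  (M *m M')^t* = M'^t* *m M^t* by rewrite trmx_mul map_mxM.
have tcK p q (M : 'M[C]_(p, q)) : M^t*^t* = M.
  by apply/matrixP => x y; rewrite !mxE conjCK.
have XX : X^t* *m X = S^t* *m diag_mx D *m S.
  rewrite -invmx_unitary ?spectral_unitarymx //; apply/orthomx_spectralP.
  by apply/normalmxP; rewrite tcM tcK.
pose Y := X *m S^t*.
have YY k l : \sum_y (Y y k)^* * Y y l = (k == l)%:R * D 0 k.
  have : Y^t* *m Y = diag_mx D.
    rewrite /Y tcM tcK -mulmxA (mulmxA (X^t*) ) XX !mulmxA SSt mul1mx.
    by rewrite -mulmxA SSt mulmx1.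
  move=> /matrixP /(_ k l); rewrite !mxE mulr_natl => <-.
  by apply: eq_bigr => y _; rewrite !mxE.
have D0 k : 0 <= D 0 k.
  have := YY k k; rewrite eqxx mul1r => <-.
  by apply: sumr_ge0 => y _; rewrite mulrC mul_conjC_ge0.
pose s k := sqrtC (D 0 k).
have s0 k : 0 <= s k by rewrite sqrtC_ge0.
have sD k : D 0 k = s k ^+ 2 by rewrite sqrtCK.
have sK k : (s k)^-1 * s k ^+ 2 = s k.
  have [->|sk] := eqVneq (s k) 0; first by rewrite expr0n mulr0.
  by rewrite expr2 mulKf.
(* Since [0^-1 = 0], vanishing singular values do not contribute to [U]. *)
pose U x y := \sum_k (S k x)^* * ((s k)^-1 * (Y y k)^*).
have UX : \sum_x \sum_y U x y * X y x = trace_norm X.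
  transitivity (\sum_k (s k)^-1 * \sum_y (Y y k)^* * Y y k); last first.
    by apply: eq_bigr => k _; rewrite YY eqxx mul1r [in LHS]sD sK.
  transitivity (\sum_k \sum_x \sum_y
      (S k x)^* * ((s k)^-1 * (Y y k)^*) * X y x).
    rewrite [RHS]exchange_big; apply: eq_bigr => x _ /=.
    by rewrite [RHS]exchange_big; apply: eq_bigr => y _; rewrite mulr_suml.
  apply: eq_bigr => k _; rewrite exchange_big mulr_sumr.
  apply: eq_bigr => y _; rewrite [Y y k in RHS]mxE !mulr_sumr.
  by apply: eq_bigr => x _; rewrite !mxE; ring.
suff Um : opnorm_le U 1.
  have := Xc _ _ Um; rewrite UX mul1r ger0_norm //.
  by apply: sumr_ge0 => k _; apply: s0.
split=> // f g; rewrite mul1r.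
pose h k := \sum_x g x * (S k x)^*.
pose w y := \sum_k h k * ((s k)^-1 * (Y y k)^*).
have -> : \sum_x \sum_y g x * U x y * f y = \sum_y f y * w y.
  rewrite exchange_big; apply: eq_bigr => y _.
  rewrite -mulr_suml mulrC; congr (_ * _).
  transitivity (\sum_x \sum_k g x * ((S k x)^* * ((s k)^-1 * (Y y k)^*))).
    by apply: eq_bigr => x _; rewrite mulr_sumr.
  rewrite exchange_big; apply: eq_bigr => k _; rewrite mulr_suml.
  by apply: eq_bigr => x _; rewrite mulrA.
apply: le_trans (cauchy_schwarz _ _) _; rewrite ler_wpM2l ?vnorm_ge0 //.
apply: (@le_trans _ _ (vnorm h)); apply: vnorm_le.
  rewrite (@vnorm_sqr_orthogonal _ _ _ (fun k => (s k != 0)%:R)).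
    rewrite vnorm_sqr; apply: ler_sum => k _.
    by rewrite ler_piMr ?exprn_ge0 ?lern1 ?leq_b1.
  move=> k l.
  transitivity ((s k)^-1 * (s l)^-1 * \sum_y (Y y k)^* * Y y l).
    rewrite mulr_sumr; apply: eq_bigr => y _.
    rewrite rmorphM /= conjCK (@conj_Creal _ (s l)^-1); first by ring.
    by rewrite ger0_real ?invr_ge0.
  rewrite YY; case: eqVneq => [<-|_]; last by rewrite !mul0r mulr0.
  rewrite !mul1r sD; have [->|sk] := eqVneq (s k) 0.
    by rewrite invr0 !mul0r.
  by rewrite mulrAC expr2 mulKf // divff.
rewrite (@vnorm_sqr_orthogonal _ _ _ (fun k => 1)).
  by rewrite vnorm_sqr; under eq_bigr do rewrite mulr1.
move=> x y; have /matrixP /(_ x y) := StS; rewrite !mxE mulr1 => <-.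
by apply: eq_bigr => k _; rewrite !mxE conjCK.
Qed.

End TraceNorm.

(** * Projections onto and away from a unit vector *)

Section Rejection.
Context {R : realType}.
Local Notation C := R[i].

(** The coefficients [<phi, f s>] of a family of vectors. *)
Definition coefficient (S T : finType) (phi : T -> C) (f : S -> T -> C) :
    S -> C :=
  fun s => \sum_a (phi a)^* * f s a.

(** [(1 - |phi><phi|) f s], when [phi] is a unit vector. *)
Definition reject (S T : finType) (phi : T -> C) (f : S -> T -> C) :
    S -> T -> C :=
  fun s a => f s a - phi a * coefficient phi f s.

Lemma unit_sum (T : finType) (phi : T -> C) :
  vnorm phi = 1 -> \sum_a (phi a)^* * phi a = 1.
Proof.
move=> phi1; transitivity (vnorm phi ^+ 2); last by rewrite phi1 expr1n.
by rewrite vnorm_sqrM; apply: eq_bigr => a _; rewrite mulrC.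
Qed.

Lemma coefficient_reject (S T : finType) (phi : T -> C) (f : S -> T -> C) s :
  vnorm phi = 1 -> coefficient phi (reject phi f) s = 0.
Proof.
move=> phi1; rewrite /coefficient /reject.
under eq_bigr do rewrite mulrBr mulrA.
by rewrite sumrB -mulr_suml unit_sum // mul1r subrr.
Qed.

Lemma sum_orthogonal (T : finType) (u v : T -> C) (a b a' b' : C) :
  vnorm u = 1 -> \sum_x (u x)^* * v x = 0 ->
  \sum_x (a * u x + b * v x) * (a' * u x + b' * v x)^* =
  a * a'^* + b * b'^* * vnorm v ^+ 2.
Proof.
move=> u1 uv.
have vu : \sum_x u x * (v x)^* = 0.
  transitivity ((\sum_x (u x)^* * v x)^*); last by rewrite uv conjC0.
  by rewrite rmorph_sum; apply: eq_bigr => x _; rewrite rmorphM /= conjCK.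
transitivity (a * a'^* * (\sum_x (u x)^* * u x)
   + a * b'^* * (\sum_x u x * (v x)^*)
   + b * a'^* * (\sum_x (u x)^* * v x) + b * b'^* * (\sum_x v x * (v x)^*)).
  rewrite !mulr_sumr -!big_split; apply: eq_bigr => x _ /=.
  by rewrite rmorphD !rmorphM /=; ring.
by rewrite unit_sum // uv vu -vnorm_sqrM; ring.
Qed.

Lemma hsnorm_pythagoras (S T : finType) (phi : T -> C) (f : S -> T -> C) :
  vnorm phi = 1 ->
  hsnorm f ^+ 2 = vnorm (coefficient phi f) ^+ 2 + hsnorm (reject phi f) ^+ 2.
Proof.
move=> phi1; rewrite !hsnorm_sqr [vnorm (coefficient _ _) ^+ 2]vnorm_sqrM.
rewrite -big_split; apply: eq_bigr => s _ /=.
have := sum_orthogonal (coefficient phi f s) 1 (coefficient phi f s) 1 phi1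
  (coefficient_reject f s phi1).
rewrite conjC1 !mul1r => <-; rewrite vnorm_sqrM.
apply: eq_bigr => a _; rewrite /reject.
by have -> : forall u v w : C, u * v + 1 * (w - v * u) = w by move=> *; ring.
Qed.

Lemma vnorm_coefficient_le (S T : finType) (phi : T -> C) (f : S -> T -> C) :
  vnorm phi = 1 -> vnorm (coefficient phi f) <= hsnorm f.
Proof.
move=> phi1; apply: vnorm_le.
by rewrite -/(hsnorm f) (hsnorm_pythagoras f phi1) lerDl exprn_ge0 ?hsnorm_ge0.
Qed.

Lemma hsnorm_reject_le (S T : finType) (phi : T -> C) (f : S -> T -> C) :
  vnorm phi = 1 -> hsnorm (reject phi f) <= hsnorm f.
Proof.
move=> phi1; apply: vnorm_le.
by rewrite -/(hsnorm f) (hsnorm_pythagoras f phi1) lerDr exprn_ge0 ?vnorm_ge0.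
Qed.

Lemma nuclear_le_outer (T : finType) (phi : T -> C) :
  vnorm phi = 1 -> nuclear_le (fun x y => phi x * (phi y)^*) 1.
Proof.
move=> phi1; have := nuclear_le_gram (fun _ : unit => phi) (fun _ : unit => phi).
have -> : hsnorm (fun _ : unit => phi) = 1.
  apply: (@pexpIrn _ 2); rewrite ?nnegrE ?hsnorm_ge0 ?ler01 // hsnorm_sqr.
  by rewrite big_const card_unit /= addr0 phi1.
rewrite mulr1; apply: nuclear_le_eq => x y.
by rewrite /gram big_const card_unit /= addr0.
Qed.

(** A perturbation [h] of a unit family [f] changes the density
    [\sum_s |f s><f s|] to first order in [h]. *)
Lemma nuclear_le_gram_sub (S T : finType) (f h : S -> T -> C) :
  hsnorm f = 1 -> hsnorm h <= 1 ->
  nuclear_le (fun x y => gram f f x y -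
    gram (fun s a => f s a - h s a) (fun s a => f s a - h s a) x y)
    (3 * hsnorm h).
Proof.
move=> f1 h1.
apply: (@nuclear_leW _ _ _ (hsnorm h * hsnorm f + hsnorm f * hsnorm h
                           + hsnorm h * hsnorm h)).
  have -> : 3 * hsnorm h = hsnorm h * 1 + 1 * hsnorm h + 1 * hsnorm h by ring.
  by rewrite f1 lerD2l ler_wpM2r ?hsnorm_ge0.
have := nuclear_leD (nuclear_leD (nuclear_le_gram h f) (nuclear_le_gram f h))
  (nuclear_leN (nuclear_le_gram h h)).
apply: nuclear_le_eq => x y; rewrite /gram -!sumrN -!big_split.
by apply: eq_bigr => s _ /=; rewrite rmorphB /=; ring.
Qed.

(** If the rejection of a unit family from [phi] is small, its density is close
    to [|phi><phi|]. *)
Lemma nuclear_le_gram_outer (S T : finType) (phi : T -> C) (f : S -> T -> C) :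
  vnorm phi = 1 -> hsnorm f = 1 ->
  nuclear_le (fun x y => gram f f x y - phi x * (phi y)^*)
    (4 * hsnorm (reject phi f)).
Proof.
move=> phi1 f1; set e := hsnorm (reject phi f).
have e1 : e <= 1 by rewrite -f1 hsnorm_reject_le.
have e0 : 0 <= e by apply: hsnorm_ge0.
apply: (@nuclear_leW _ _ _ (3 * e + `|- e ^+ 2| * 1)).
  rewrite normrN ger0_norm ?exprn_ge0 // mulr1.
  have -> : 4 * e = 3 * e + e * 1 by ring.
  by rewrite lerD2l expr2 ler_wpM2l.
have := nuclear_leD (nuclear_le_gram_sub f1 e1)
  (nuclear_leZ (- e ^+ 2) (nuclear_le_outer phi1)).
apply: nuclear_le_eq => x y.
have -> : gram (fun s a => f s a - reject phi f s a)
    (fun s a => f s a - reject phi f s a) x y =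
    vnorm (coefficient phi f) ^+ 2 * (phi x * (phi y)^*).
  rewrite vnorm_sqrM mulr_suml; apply: eq_bigr => s _.
  by rewrite /reject !subKr rmorphM; ring.
have := hsnorm_pythagoras f phi1; rewrite f1 expr1n -/e => E.
have -> : e ^+ 2 = 1 - vnorm (coefficient phi f) ^+ 2 by rewrite E; ring.
ring.
Qed.

End Rejection.

(** * Correlations of a bipartite density *)

Section Bipartite.
Context {R : realType}.
Local Notation C := R[i].
Variables (S T1 T2 : finType).
Implicit Types psi : S -> T1 * T2 -> C.

(** The vectors of one tensor factor obtained by fixing the index of the
    other. Their density is the partial trace of the density of [psi]. *)
Definition slice1 psi : S * T2 -> T1 -> C := fun p a => psi p.1 (a, p.2).
Definition slice2 psi : S * T1 -> T2 -> C := fun p b => psi p.1 (p.2, b).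

(** The action of [(1 - |phi><phi|)] on one of the two tensor factors. *)
Definition reject1 (phi : T1 -> C) psi : S -> T1 * T2 -> C :=
  fun s p => reject phi (slice1 psi) (s, p.2) p.1.
Definition reject2 (chi : T2 -> C) psi : S -> T1 * T2 -> C :=
  fun s p => reject chi (slice2 psi) (s, p.1) p.2.

Lemma hsnorm_slice1 psi : hsnorm (slice1 psi) = hsnorm psi.
Proof.
congr sqrtC; rewrite !sum_pair; apply: eq_bigr => s _.
by rewrite sum_pair exchange_big.
Qed.

Lemma hsnorm_slice2 psi : hsnorm (slice2 psi) = hsnorm psi.
Proof.
congr sqrtC; rewrite !sum_pair; apply: eq_bigr => s _.
by rewrite sum_pair.
Qed.

Lemma hsnorm_reject1 phi psi :
  hsnorm (reject phi (slice1 psi)) = hsnorm (reject1 phi psi).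
Proof. by rewrite -hsnorm_slice1; apply: eq_vnorm => -[[]]. Qed.

Lemma hsnorm_reject2 chi psi :
  hsnorm (reject chi (slice2 psi)) = hsnorm (reject2 chi psi).
Proof. by rewrite -hsnorm_slice2; apply: eq_vnorm => -[[]]. Qed.

Section Decomposition.
Variables (phi : T1 -> C) (chi : T2 -> C) (psi : S -> T1 * T2 -> C).
Hypotheses (phi1 : vnorm phi = 1) (chi1 : vnorm chi = 1).

(** The components of
    [psi = phi (x) chi c + x (x) chi + phi (x) y + z]. *)
Let c : S -> C :=
  coefficient phi (fun s a => coefficient chi (slice2 psi) (s, a)).
Let x : S -> T1 -> C :=
  reject phi (fun s a => coefficient chi (slice2 psi) (s, a)).
Let y : S -> T2 -> C :=
  reject chi (fun s b => coefficient phi (slice1 psi) (s, b)).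
Let z : S -> T1 * T2 -> C := reject1 phi (reject2 chi psi).

Lemma coefficientC s :
  c s = coefficient chi (fun s b => coefficient phi (slice1 psi) (s, b)) s.
Proof.
rewrite /c /coefficient /slice1 /slice2 /=.
under eq_bigr do rewrite mulr_sumr.
rewrite exchange_big; apply: eq_bigr => b _; rewrite mulr_sumr.
by apply: eq_bigr => a _; rewrite mulrCA.
Qed.

Lemma coefficient_reject2 s b :
  coefficient phi (slice1 (reject2 chi psi)) (s, b) = y s b.
Proof.
rewrite /y /reject -coefficientC /c /coefficient mulr_sumr -sumrB.
apply: eq_bigr => a _.
by rewrite /slice1 /reject2 /reject /coefficient /slice2 /=; ring.
Qed.

Lemma coefficient_reject1 s a :
  coefficient chi (slice2 (reject1 phi psi)) (s, a) = x s a.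
Proof.
rewrite /x /reject -/c -/(c s) coefficientC /coefficient mulr_sumr -sumrB.
apply: eq_bigr => b _.
by rewrite /slice2 /reject1 /reject /coefficient /slice1 /=; ring.
Qed.

Lemma bipartite_decomposition s p :
  psi s p - z s p =
  phi p.1 * chi p.2 * c s + x s p.1 * chi p.2 + phi p.1 * y s p.2.
Proof.
case: p => a b; rewrite /z /reject1 {1}/reject coefficient_reject2.
by rewrite /slice1 /reject2 /x /reject /slice2 /= -/c -/(c s); ring.
Qed.

Lemma vnorm_coefficient2_sqr : vnorm (coefficient chi (slice2 psi)) ^+ 2 =
  vnorm c ^+ 2 + hsnorm x ^+ 2.
Proof.
by rewrite -hsnorm_pythagoras.
Qed.

Lemma hsnorm_reject2_sqr :
  hsnorm (reject2 chi psi) ^+ 2 = hsnorm y ^+ 2 + hsnorm z ^+ 2.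
Proof.
rewrite -[in LHS]hsnorm_slice1 (hsnorm_pythagoras _ phi1) hsnorm_reject1.
congr (_ ^+ 2 + _); apply: eq_vnorm => -[s b]; exact: coefficient_reject2.
Qed.

Lemma hsnorm_decomposition :
  hsnorm psi ^+ 2 =
  vnorm c ^+ 2 + hsnorm x ^+ 2 + hsnorm y ^+ 2 + hsnorm z ^+ 2.
Proof.
rewrite -hsnorm_slice2 (hsnorm_pythagoras _ chi1) hsnorm_reject2.
by rewrite vnorm_coefficient2_sqr hsnorm_reject2_sqr addrA.
Qed.

Lemma hsnorm_excitation1_le : hsnorm x <= hsnorm (reject1 phi psi).
Proof.
rewrite -hsnorm_slice2; apply: le_trans (vnorm_coefficient_le _ chi1).
rewrite le_eqVlt; apply/orP; left; apply/eqP; apply: eq_vnorm => -[s a].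
by rewrite coefficient_reject1.
Qed.

Lemma hsnorm_excitation2_le : hsnorm y <= hsnorm (reject2 chi psi).
Proof.
apply: vnorm_le; rewrite -!/(hsnorm _).
by rewrite hsnorm_reject2_sqr lerDl exprn_ge0 ?hsnorm_ge0.
Qed.

Let psi0 (s : S) p := psi s p - z s p.

(** The density of [psi - z] is almost determined by its two partial traces:
    they miss the terms in which the two factors are excited on opposite
    sides, and [hsnorm z ^+ 2], the defect in the normalisation of
    [psi - z]. *)
Lemma gram_first_order p q :
  hsnorm psi = 1 ->
  gram psi0 psi0 p q
  - gram (slice1 psi0) (slice1 psi0) p.1 q.1 * (chi p.2 * (chi q.2)^*)
  - phi p.1 * (phi q.1)^* * gram (slice2 psi0) (slice2 psi0) p.2 q.2
  + phi p.1 * (phi q.1)^* * (chi p.2 * (chi q.2)^*) =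
  gram (fun s r => x s r.1 * chi r.2) (fun s r => phi r.1 * y s r.2) p q
  + gram (fun s r => phi r.1 * y s r.2) (fun s r => x s r.1 * chi r.2) p q
  + hsnorm z ^+ 2 * (phi p.1 * (phi q.1)^* * (chi p.2 * (chi q.2)^*)).
Proof.
case: p q => [a b] [a' b'] psi1 /=.
have xphi s : \sum_a (phi a)^* * x s a = 0 by apply: coefficient_reject.
have ychi s : \sum_b (chi b)^* * y s b = 0 by apply: coefficient_reject.
have E1 : gram (slice1 psi0) (slice1 psi0) a a' = \sum_s
    ((phi a * c s + x s a) * (phi a' * c s + x s a')^* +
     phi a * (phi a')^* * vnorm (y s) ^+ 2).
  rewrite /gram sum_pair; apply: eq_bigr => s _.
  rewrite -(sum_orthogonal (phi a * c s + x s a) (phi a)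
    (phi a' * c s + x s a') (phi a') chi1 (ychi s)); apply: eq_bigr => b0 _.
  rewrite /slice1 /psi0 !bipartite_decomposition /=.
  by congr (_ * Num.conj _); ring.
have E2 : gram (slice2 psi0) (slice2 psi0) b b' = \sum_s
    ((chi b * c s + y s b) * (chi b' * c s + y s b')^* +
     chi b * (chi b')^* * vnorm (x s) ^+ 2).
  rewrite /gram sum_pair; apply: eq_bigr => s _.
  rewrite -(sum_orthogonal (chi b * c s + y s b) (chi b)
    (chi b' * c s + y s b') (chi b') phi1 (xphi s)); apply: eq_bigr => a0 _.
  rewrite /slice2 /psi0 !bipartite_decomposition /=.
  by congr (_ * Num.conj _); ring.
have -> : hsnorm z ^+ 2 = 1 - \sum_s
    (c s * (c s)^* + vnorm (x s) ^+ 2 + vnorm (y s) ^+ 2).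
  have := hsnorm_decomposition; rewrite psi1 expr1n => ->.
  by rewrite !big_split /= -vnorm_sqrM -!hsnorm_sqr; ring.
rewrite E1 E2 /gram mulrBl mul1r !mulr_suml mulr_sumr.
rewrite addrA [RHS]addrAC; congr (_ + _).
rewrite -!sumrN -!big_split; apply: eq_bigr => s _ /=.
rewrite /psi0 !bipartite_decomposition /=.
move: (c s) (x s) (y s) => cs xs ys; rewrite !rmorphD !rmorphM /=; ring.
Qed.

End Decomposition.

Lemma hsnorm_tensorr (f : S -> T1 -> C) (g : T2 -> C) :
  hsnorm (fun s (r : T1 * T2) => f s r.1 * g r.2) = hsnorm f * vnorm g.
Proof.
apply: (@pexpIrn _ 2); rewrite ?nnegrE ?mulr_ge0 ?hsnorm_ge0 ?vnorm_ge0 //.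
rewrite exprMn !hsnorm_sqr mulr_suml.
by apply: eq_bigr => s _; rewrite vnorm_tensor exprMn.
Qed.

Lemma hsnorm_tensorl (f : T1 -> C) (g : S -> T2 -> C) :
  hsnorm (fun s (r : T1 * T2) => f r.1 * g s r.2) = vnorm f * hsnorm g.
Proof.
apply: (@pexpIrn _ 2); rewrite ?nnegrE ?mulr_ge0 ?hsnorm_ge0 ?vnorm_ge0 //.
rewrite exprMn !hsnorm_sqr mulr_sumr.
by apply: eq_bigr => s _; rewrite vnorm_tensor exprMn.
Qed.

(** With [P], [Q] the projections on [phi], [chi] and [G1], [G2] the partial
    traces of the density [G12] of [psi], the correlation is the sum of
    [G12 - G1 (x) Q - P (x) G2 + P (x) Q], reduced to [gram_first_order] at the
    price of nine times the norm of the double excitation, and of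
    [- (G1 - P) (x) (G2 - Q)]. *)
Lemma nuclear_le_correlation phi chi psi :
  vnorm phi = 1 -> vnorm chi = 1 -> hsnorm psi = 1 ->
  nuclear_le (fun p q => gram psi psi p q -
      gram (slice1 psi) (slice1 psi) p.1 q.1 *
      gram (slice2 psi) (slice2 psi) p.2 q.2)
    (64 * (hsnorm (reject1 phi (reject2 chi psi)) +
           hsnorm (reject1 phi psi) ^+ 2 + hsnorm (reject2 chi psi) ^+ 2)).
Proof.
move=> phi1 chi1 psi1; set z := reject1 phi _.
set e := hsnorm z; set ei := hsnorm (reject1 phi psi).
set ej := hsnorm (reject2 chi psi).
have e0 : 0 <= e by apply: hsnorm_ge0.
have ei0 : 0 <= ei by apply: hsnorm_ge0.
have ej0 : 0 <= ej by apply: hsnorm_ge0.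
have e1 : e <= 1.
  rewrite -psi1 /e /z -hsnorm_reject1.
  apply: le_trans (hsnorm_reject_le _ phi1) _.
  by rewrite hsnorm_slice1 -hsnorm_reject2 -hsnorm_slice2 hsnorm_reject_le.
pose P := fun a a' => phi a * (phi a')^*.
pose Q := fun b b' => chi b * (chi b')^*.
have Pn : nuclear_le P 1 by apply: nuclear_le_outer.
have Qn : nuclear_le Q 1 by apply: nuclear_le_outer.
pose x := reject phi (fun s a => coefficient chi (slice2 psi) (s, a)).
pose y := reject chi (fun s b => coefficient phi (slice1 psi) (s, b)).
have s1 : hsnorm (slice1 psi) = 1 by rewrite hsnorm_slice1.
have s2 : hsnorm (slice2 psi) = 1 by rewrite hsnorm_slice2.
have z1 : hsnorm (slice1 z) = e by rewrite hsnorm_slice1.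
have z2 : hsnorm (slice2 z) = e by rewrite hsnorm_slice2.
have E := nuclear_le_gram_sub psi1 e1.
have := nuclear_le_gram_sub s1 (_ : hsnorm (slice1 z) <= 1).
rewrite z1 => /(_ e1) E1.
have := nuclear_le_gram_sub s2 (_ : hsnorm (slice2 z) <= 1).
rewrite z2 => /(_ e1) E2.
have D1 := nuclear_le_gram_outer phi1 s1.
have D2 := nuclear_le_gram_outer chi1 s2.
have XY : nuclear_le (gram (fun s r => x s r.1 * chi r.2)
    (fun s (r : T1 * T2) => phi r.1 * y s r.2)) (ei * ej).
  apply: nuclear_leW (nuclear_le_gram _ _).
  rewrite hsnorm_tensorr hsnorm_tensorl phi1 chi1 mulr1 mul1r.
  by rewrite ler_pM ?hsnorm_ge0 ?hsnorm_excitation1_le ?hsnorm_excitation2_le.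
have YX : nuclear_le (gram (fun s (r : T1 * T2) => phi r.1 * y s r.2)
    (fun s r => x s r.1 * chi r.2)) (ei * ej).
  apply: nuclear_leW (nuclear_le_gram _ _).
  rewrite hsnorm_tensorr hsnorm_tensorl phi1 chi1 mulr1 mul1r mulrC.
  by rewrite ler_pM ?hsnorm_ge0 ?hsnorm_excitation1_le ?hsnorm_excitation2_le.
have W := nuclear_leD (nuclear_leD (nuclear_leD (nuclear_leD E
  (nuclear_leN (nuclear_leD (nuclear_le_tensor E1 Qn) (nuclear_le_tensor Pn E2))))
  (nuclear_leD XY YX)) (nuclear_leZ (e ^+ 2) (nuclear_le_tensor Pn Qn)))
  (nuclear_leN (nuclear_le_tensor D1 D2)).
apply: nuclear_leW (nuclear_le_eq _ W) => [|p q]; last first.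
  have := gram_first_order phi1 chi1 p q psi1; rewrite -/e -/x -/y -/z /=.
  move=> /(congr1 (fun u => u - e ^+ 2 * (P p.1 q.1 * Q p.2 q.2))).
  rewrite addrK /tensor /P /Q => <-.
  by rewrite /slice1 /slice2 /=; ring.
rewrite hsnorm_reject1 hsnorm_reject2 -/ei -/ej ger0_norm ?exprn_ge0 //.
have ee : e ^+ 2 <= e by rewrite expr2 ler_piMl.
have eij : 0 <= (ei - ej) ^+ 2.
  by rewrite real_exprn_even_ge0 // rpredB ?ger0_real.
(* [2 + 16] times [ei * ej] is at most [9 * (ei ^+ 2 + ej ^+ 2)]. *)
rewrite -subr_ge0.
have -> : 64 * (e + ei ^+ 2 + ej ^+ 2) -
  (3 * e + (3 * e * 1 + 1 * (3 * e)) + (ei * ej + ei * ej) + e ^+ 2 * (1 * 1) +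
   4 * ei * (4 * ej)) =
  (e - e ^+ 2) + 54 * e + 9 * (ei - ej) ^+ 2 + 55 * (ei ^+ 2 + ej ^+ 2) by ring.
rewrite -addrA -addrA; apply: addr_ge0; first by rewrite subr_ge0.
apply: addr_ge0; first by rewrite mulr_ge0 ?ler0n.
apply: addr_ge0; first by rewrite mulr_ge0 ?ler0n.
by rewrite mulr_ge0 ?ler0n // addr_ge0 ?exprn_ge0.
Qed.

End Bipartite.

(** * Two slots of a wave function on configurations *)

Section TwoSlots.
Context {R : realType} (N d : nat).
Local Notation C := R[i].
Variables (i j : 'I_N) (a0 : 'I_d).
Hypothesis ij : i != j.
Implicit Types (Psi : config N d -> C) (y : config N d).

(** [Psi] as a family of vectors on slots [i] and [j]. The states of the other
    slots are represented by the configurations with the value [a0] at [i] and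
    [j], all other configurations contributing the zero vector. *)
Definition two_slots Psi : config N d -> 'I_d * 'I_d -> C :=
  fun y p => if (y i == a0) && (y j == a0)
             then Psi (update (update y i p.1) j p.2) else 0.

Lemma update_i y a b : update (update y i a) j b i = a.
Proof. by rewrite !ffunE (negPf ij) eqxx. Qed.

Lemma update_j y a b : update (update y i a) j b j = b.
Proof. by rewrite !ffunE eqxx. Qed.

Lemma update_update_i y a b a' :
  update (update (update y i a) j b) i a' = update (update y i a') j b.
Proof.
apply/ffunP => k; rewrite !ffunE.
by have [->|//] := eqVneq k i; rewrite (negPf ij).
Qed.

Lemma update_update_j y a b b' :
  update (update (update y i a) j b) j b' = update (update y i a) j b'.
Proof. by apply/ffunP => k; rewrite !ffunE; case: (k == j). Qed.

(** A configuration is determined by its values at [i] and [j] and by its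
    values elsewhere, the latter represented as in [two_slots]. *)
Lemma sum_two_slots (F : config N d -> C) :
  \sum_x F x = \sum_(y : config N d | (y i == a0) && (y j == a0))
    \sum_(p : 'I_d * 'I_d) F (update (update y i p.1) j p.2).
Proof.
rewrite pair_big_dep /=.
rewrite (reindex_onto
  (fun q : config N d * ('I_d * 'I_d) => update (update q.1 i q.2.1) j q.2.2)
  (fun x => (update (update x i a0) j a0, (x i, x j)))) /=.
  apply: eq_bigl => -[y [a b]] /=; rewrite andbT update_i update_j.
  rewrite update_update_i update_update_j xpair_eqE eqxx andbT.
  apply/eqP/andP => [<-|[/eqP yi /eqP yj]]; first by rewrite update_i update_j.
  apply/ffunP => k; rewrite !ffunE; case: eqVneq => [->|_]; first by rewrite yj.
  by case: eqVneq => [->|//]; rewrite yi.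
move=> x _; rewrite update_update_i update_update_j; apply/ffunP => k.
by rewrite !ffunE; case: eqVneq => [->|_] //; case: eqVneq => [->|_].
Qed.

Lemma hsnorm_two_slots Psi : hsnorm (two_slots Psi) = vnorm Psi.
Proof.
congr sqrtC; rewrite sum_pair [RHS]sum_two_slots [RHS]big_mkcond.
apply: eq_bigr => y _; rewrite /two_slots /=.
by case: ifP => // _; rewrite big1 // => p _; rewrite normr0 expr0n.
Qed.

Lemma reduced2_two_slots Psi k k' :
  reduced2 (pure_kernel Psi) i j k k' =
  gram (two_slots Psi) (two_slots Psi) (mxtens_unindex k) (mxtens_unindex k').
Proof.
rewrite mxE big_mkcond sum_two_slots /gram [LHS]big_mkcond.
apply: eq_bigr => y _; rewrite /two_slots; case: ifP => _; last first.
  by rewrite mul0r.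
rewrite (bigD1 (mxtens_unindex k)) //= big1 => [|p pk].
  by rewrite addr0 update_i update_j eqxx update_update_i update_update_j.
by rewrite update_i update_j -surjective_pairing (negPf pk).
Qed.

Lemma reduced1_two_slots_i Psi a a' :
  reduced1 (pure_kernel Psi) i a a' =
  gram (slice1 (two_slots Psi)) (slice1 (two_slots Psi)) a a'.
Proof.
rewrite mxE big_mkcond sum_two_slots /gram sum_pair [LHS]big_mkcond.
apply: eq_bigr => y _; rewrite /slice1 /two_slots /=; case: ifP => _; last first.
  by rewrite big1 // => b _; rewrite mul0r.
rewrite sum_pair exchange_big; apply: eq_bigr => b _ /=.
rewrite (bigD1 a) //= big1 => [|a1 a1a].
  by rewrite addr0 update_i eqxx update_update_i.
by rewrite update_i (negPf a1a).
Qed.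

Lemma reduced1_two_slots_j Psi b b' :
  reduced1 (pure_kernel Psi) j b b' =
  gram (slice2 (two_slots Psi)) (slice2 (two_slots Psi)) b b'.
Proof.
rewrite mxE big_mkcond sum_two_slots /gram sum_pair [LHS]big_mkcond.
apply: eq_bigr => y _; rewrite /slice2 /two_slots /=; case: ifP => _; last first.
  by rewrite big1 // => a _; rewrite mul0r.
rewrite sum_pair; apply: eq_bigr => a _ /=.
rewrite (bigD1 b) //= big1 => [|b1 b1b].
  by rewrite addr0 update_j eqxx update_update_j.
by rewrite update_j (negPf b1b).
Qed.

Lemma sum_1_sub_ketbra (phi : 'cV[C]_d) a (f : 'I_d -> C) :
  \sum_b (1%:M - ketbra phi) a b * f b =
  f a - phi a 0 * \sum_b (phi b 0)^* * f b.
Proof.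
transitivity (\sum_b ((a == b)%:R * f b - phi a 0 * ((phi b 0)^* * f b))).
  by apply: eq_bigr => b _; rewrite !mxE big_ord1 !mxE mulrBl mulrA.
rewrite sumrB -mulr_sumr (bigD1 a) //= eqxx mul1r big1 ?addr0 // => b ba.
by rewrite eq_sym (negPf ba) mul0r.
Qed.

Lemma excite_two_slots_i (phi : 'cV[C]_d) Psi y p :
  two_slots (excite phi i Psi) y p =
  reject1 (fun a => phi a 0) (two_slots Psi) y p.
Proof.
rewrite /reject1 /reject /coefficient /slice1 /two_slots /=.
case: ifP => _; last by rewrite big1 ?mulr0 ?subr0 // => a _; rewrite mulr0.
rewrite /excite /slot update_i.
rewrite -(sum_1_sub_ketbra phi p.1 (fun a => Psi (update (update y i a) j p.2))).
by apply: eq_bigr => a _; rewrite update_update_i.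
Qed.

Lemma excite_two_slots_j (phi : 'cV[C]_d) Psi y p :
  two_slots (excite phi j Psi) y p =
  reject2 (fun a => phi a 0) (two_slots Psi) y p.
Proof.
rewrite /reject2 /reject /coefficient /slice2 /two_slots /=.
case: ifP => _; last by rewrite big1 ?mulr0 ?subr0 // => b _; rewrite mulr0.
rewrite /excite /slot update_j.
rewrite -(sum_1_sub_ketbra phi p.2 (fun b => Psi (update (update y i p.1) j b))).
by apply: eq_bigr => b _; rewrite update_update_j.
Qed.

Lemma vnorm_excite_i (phi : 'cV[C]_d) Psi : vnorm (excite phi i Psi) =
  hsnorm (reject1 (fun a => phi a 0) (two_slots Psi)).
Proof.
rewrite -hsnorm_two_slots; apply: eq_vnorm => -[y p].
exact: excite_two_slots_i.
Qed.

Lemma vnorm_excite_j (phi : 'cV[C]_d) Psi : vnorm (excite phi j Psi) =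
  hsnorm (reject2 (fun a => phi a 0) (two_slots Psi)).
Proof.
rewrite -hsnorm_two_slots; apply: eq_vnorm => -[y p].
exact: excite_two_slots_j.
Qed.

Lemma vnorm_excite_ij (phi chi : 'cV[C]_d) Psi :
  vnorm (excite phi i (excite chi j Psi)) =
  hsnorm (reject1 (fun a => phi a 0)
            (reject2 (fun a => chi a 0) (two_slots Psi))).
Proof.
rewrite vnorm_excite_i; congr (hsnorm (reject1 _ _)).
by apply/funext => y; apply/funext => p; apply: excite_two_slots_j.
Qed.

(** The slot [j] and the state [a0] enter only through the encoding
    [two_slots]. *)
Lemma trace_norm_reduced1_sub (phi : 'cV[C]_d) Psi :
  vnorm Psi = 1 -> unit_vector phi ->
  trace_norm (reduced1 (pure_kernel Psi) i - ketbra phi) <=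
    4 * vnorm (excite phi i Psi).
Proof.
move=> Psi1 phi1; apply: trace_norm_le.
rewrite vnorm_excite_i -hsnorm_reject1.
have sl1 : hsnorm (slice1 (two_slots Psi)) = 1.
  by rewrite hsnorm_slice1 hsnorm_two_slots.
apply: nuclear_le_eq (nuclear_le_gram_outer phi1 sl1) => a a'.
by rewrite -reduced1_two_slots_i [in RHS]mxE [in RHS]mxE !mxE big_ord1 !mxE.
Qed.

Lemma trace_norm_correlation (phi chi : 'cV[C]_d) Psi :
  vnorm Psi = 1 -> unit_vector phi -> unit_vector chi ->
  trace_norm (correlation (pure_kernel Psi) i j) <=
    64 * (vnorm (excite phi i (excite chi j Psi))
          + vnorm (excite phi i Psi) ^+ 2 + vnorm (excite chi j Psi) ^+ 2).
Proof.
move=> Psi1 phi1 chi1; apply: trace_norm_le.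
rewrite vnorm_excite_ij vnorm_excite_i vnorm_excite_j.
have ts1 : hsnorm (two_slots Psi) = 1 by rewrite hsnorm_two_slots.
have unindex_bij : bijective (@mxtens_unindex d d).
  by exists (@mxtens_index d d); [apply: mxtens_unindexK | apply: mxtens_indexK].
apply: nuclear_le_eq
  (nuclear_le_reindex unindex_bij (nuclear_le_correlation phi1 chi1 ts1)) => k k'.
rewrite -reduced2_two_slots -reduced1_two_slots_i -reduced1_two_slots_j.
by rewrite [RHS]mxE [X in _ = _ + X]mxE [X in _ = _ - X]mxE.
Qed.

End TwoSlots.

Theorem theorem5p4 (R : realType) (disp : measure_display)
  (Omega : measurableType disp) (P : probability Omega R)
  (F : R -> set (set Omega)) (HF : filtration F)
  (d : nat) (Hd : (2 <= d)%N)
  (H L : 'M[R[i]]_d) (A : 'M[R[i]]_(d * d))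
  (H_selfadjoint : H^t* = H) (A_selfadjoint : A^t* = A)
  (A_exchange : forall x y x' y', kernel2 A x y x' y' = kernel2 A y x y' x')
  (A_transpose : forall x y x' y', kernel2 A x y x' y' = kernel2 A x' y' x y)
  (phi0 : 'cV[R[i]]_d) (phi0_unit : unit_vector phi0)
  (N : nat) (HN : (2 <= N)%N)
  (B : 'I_N -> R -> Omega -> R)
  (B_brownian : forall j, brownian_motion P F (B j))
  (B_independent : independent_processes P B)
  (Psi : R -> Omega -> config N d -> R[i])
  (Psi_filter : particle_filter P F H L A phi0 B Psi)
  (gamma : 'I_N -> R -> Omega -> 'M[R[i]]_d)
  (phi : 'I_N -> R -> Omega -> 'cV[R[i]]_d)
  (gamma_filter : forall j : 'I_N, reference_filter P F H L A phi0
     (mean_state P (gamma (Ordinal (ltnW HN)))) (B j) (gamma j) (phi j)) :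
  forall (w : Omega) (t : R) (i j : 'I_N), 0 <= t -> i != j ->
    let Gam := pure_kernel (Psi t w) in
    let eps k := vnorm (excite (phi k t w) k (Psi t w)) in
    let eps2 := vnorm (excite (phi i t w) i (excite (phi j t w) j (Psi t w))) in
    trace_norm (reduced1 Gam i - gamma i t w) <= 4 * eps i /\
    trace_norm (correlation Gam i j) <= 64 * (eps2 + eps i ^+ 2 + eps j ^+ 2).
Proof.
move=> w t i j t0 ij Gam eps eps2.
have Psi1 : vnorm (Psi t w) = 1 by case: Psi_filter => _ /(_ t w t0).
have phi_unit k : unit_vector (phi k t w).
  by case: (gamma_filter k) => _ /(_ t w t0) [].
have a0 : 'I_d := Ordinal (ltnW Hd).
split; last exact: (trace_norm_correlation a0).
have -> : gamma i t w = ketbra (phi i t w).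
  by case: (gamma_filter i) => _ /(_ t w t0) [].
exact: (trace_norm_reduced1_sub a0 ij).
Qed.
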